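(* Let $n\ge 2$. The map $\rho:\mathrm{gl}(n,\mathbb{R})\to\mathrm{gl}\big(\binom{n}{2},\mathbb{R}\big)$ defined by $\rho(A):=A\boxplus A$, where $A\boxplus A$ is the bialternate sum of $A$ with itself, is a guardian representation.
   Context: Bialternate sum. For $A=(a_{ij})\in\mathbb{R}^{n\times n}$, the bialternate sum of $A$ with itself, denoted here $A\boxplus A$, is the $\frac{n(n-1)}{2}\times\frac{n(n-1)}{2}$ matrix defined as follows. Let $L(n)$ be the ordered list of pairs $$(2,1),(3,1),\dots,(n,1),(3,2),(4,2),\dots,(n,2),\dots,(n-1,n-2),(n,n-2),(n,n-1).$$ For $x,y\in\{1,\dots,\frac{n(n-1)}{2}\}$, let $(p,q)$ be the pair in position $x$ and $(r,s)$ the pair in position $y$ of $L(n)$. Then entry $(x,y)$ of $A\boxplus A$ is $$a_{pr}\delta_{qs}+a_{qs}\delta_{pr}-a_{ps}\delta_{qr}-a_{qr}\delta_{ps},$$ where $\delta_{ij}=1$ if $i=j$ and $0$ otherwise. Lie algebra representations. $\mathrm{gl}(n,\mathbb{R})$ is the Lie algebra of all real $n\times n$ matrices with bracket $[A,B]=AB-BA$. A linear map $\rho:\mathrm{gl}(n,\mathbb{R})\to\mathrm{gl}(m,\mathbb{R})$ is a Lie algebra representation if $\rho([A,B])=[\rho(A),\rho(B)]$ for all $A,B\in\mathrm{gl}(n,\mathbb{R})$. Guardian representations. Let $\lambda_1(A),\dots,\lambda_n(A)$ denote the (complex) eigenvalues of $A\in\mathbb{R}^{n\times n}$. Consider the following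 two conditions on a function $f:\mathbb{R}^{n\times n}\to\mathbb{R}$: (G1) $f(A)\neq 0$ whenever $\mathrm{Re}(\lambda_i(A))<0$ for all $i$, and $f(A)=0$ whenever $\mathrm{Re}(\lambda_i(A))=0$ for some $i$; (G2) $f(A)\neq 0$ whenever $\mathrm{Re}(\lambda_i(A))<0$ for all $i$, and $f(A)=0$ whenever $A$ has an eigenvalue $\mathrm{i}\beta$ with $\beta\in\mathbb{R}$, $\beta\ne 0$. A map $\rho:\mathrm{gl}(n,\mathbb{R})\to\mathrm{gl}(m,\mathbb{R})$ is a guardian representation if it is a Lie algebra representation and the function $A\mapsto\det(\rho(A))$ satisfies (G1) or (G2). *)

(* Defs.v *)
From mathcomp Require Import all_boot all_order all_algebra.
From mathcomp Require Import reals complex.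

Set Implicit Arguments.
Unset Strict Implicit.
Unset Printing Implicit Defensive.

Import Order.TTheory GRing.Theory Num.Theory.
Local Open Scope ring_scope.

(* Indices are 0-based: 'I_n = {0, ..., n-1}. *)

(* The list (2,1), ..., (n,1), (3,2), ..., (n,2), ..., (n,n-1): the second
   component is the outer loop, the first one the inner loop. *)
Definition pair_seq (n : nat) : seq ('I_n * 'I_n) :=
  [seq (p, q) | q : 'I_n <- enum 'I_n,
                p : 'I_n <- [seq p : 'I_n <- enum 'I_n | (q < p)%N]].

Lemma size_pair_seq (n : nat) : size (pair_seq n) == 'C(n, 2).
Proof.
rewrite size_allpairs_dep sumnE big_map big_enum /= -bin2_sum.
under eq_bigr => q _ do rewrite size_filter -sum1_count big_enum_cond /=.
rewrite (exchange_big_dep xpredT) //= big_mkord; apply/eqP/eq_bigr => p _.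
rewrite sum1_card -[RHS](card_ord p).
have hp (q : 'I_p) : (q < n)%N by apply: ltn_trans (ltn_ord q) (ltn_ord p).
rewrite -(card_image (f := fun q : 'I_p => Ordinal (hp q))); last first.
  by move=> q q' [/val_inj].
apply: eq_card => q; rewrite unfold_in /=; apply/idP/imageP => [qp|[q' _ ->]].
  by exists (Ordinal qp) => //; apply: val_inj.
exact: (ltn_ord q').
Qed.

Definition pair_list (n : nat) : 'C(n, 2).-tuple ('I_n * 'I_n) :=
  Tuple (size_pair_seq n).

Definition bialternate_sum (R : realType) (n : nat) (A : 'M[R]_n) :
    'M[R]_('C(n, 2)) :=
  \matrix_(x, y)
    let: (p, q) := tnth (pair_list n) x in
    let: (r, s) := tnth (pair_list n) y in
    A p r * (q == s)%:R + A q s * (p == r)%:R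
    - A p s * (q == r)%:R - A q r * (p == s)%:R.

Definition lie_bracket (R : realType) (n : nat) (A B : 'M[R]_n) : 'M[R]_n :=
  A *m B - B *m A.

Definition lie_representation (R : realType) (n m : nat)
    (rho : 'M[R]_n -> 'M[R]_m) : Prop :=
  linear rho /\
  forall A B : 'M[R]_n,
    rho (lie_bracket A B) = lie_bracket (rho A) (rho B).

Definition complex_eigenvalue (R : realType) (n : nat) (A : 'M[R]_n)
    (z : R[i]) : Prop :=
  eigenvalue (map_mx (real_complex R) A) z.

Definition hurwitz_stable (R : realType) (n : nat) (A : 'M[R]_n) : Prop :=
  forall z : R[i], complex_eigenvalue A z -> complex.Re z < 0.

Definition G1 (R : realType) (n : nat) (f : 'M[R]_n -> R) : Prop :=
  (forall A : 'M[R]_n, hurwitz_stable A -> f A <> 0) /\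
  (forall A : 'M[R]_n,
     (exists z : R[i], complex_eigenvalue A z /\ complex.Re z = 0) -> f A = 0).

(* [Complex 0 b] is the number i * b. *)
Definition G2 (R : realType) (n : nat) (f : 'M[R]_n -> R) : Prop :=
  (forall A : 'M[R]_n, hurwitz_stable A -> f A <> 0) /\
  (forall A : 'M[R]_n,
     (exists b : R, b <> 0 /\ complex_eigenvalue A (Complex 0 b)) -> f A = 0).

Definition guardian_representation (R : realType) (n m : nat)
    (rho : 'M[R]_n -> 'M[R]_m) : Prop :=
  lie_representation rho /\
  (G1 (fun A => \det (rho A)) \/ G2 (fun A => \det (rho A))).

(* Main.v *)
(* The bialternate sum is the second exterior power of the defining
   representation: identifying a vector indexed by the pairs q < p with a
   skew-symmetric matrix X, it acts as X |-> A^T X + X A, and it inherits the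
   bracket from this action. Its determinant vanishes iff some skew X != 0
   satisfies X A = - A^T X. By Cayley-Hamilton such an X forces A and - A^T to
   share an eigenvalue, so that z and - z are both eigenvalues of A, which is
   impossible when A is stable. Conversely, if v A = i b v with b != 0 and w is
   the conjugate of v, then X = v^T w - w^T v is such a matrix. Hence (G2)
   holds. *)
Require Import Defs.
From mathcomp Require Import all_boot all_order all_algebra.
From mathcomp Require Import reals complex.
From mathcomp Require Import ring.

Set Implicit Arguments.
Unset Strict Implicit.
Unset Printing Implicit Defensive.

Import Order.TTheory GRing.Theory Num.Theory.
Local Open Scope ring_scope.

(** * Intertwining matrices and common eigenvalues *)

Lemma intertwining_horner_mx (F : comNzRingType) (m n : nat)
    (A : 'M[F]_n.+1) (B : 'M[F]_m.+1) (X : 'M[F]_(m.+1, n.+1)) (p : {poly F}) :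
  X *m A = B *m X -> X *m horner_mx A p = horner_mx B p *m X.
Proof.
move=> XA; elim/poly_ind: p => [|p c IHp]; first by rewrite !rmorph0 mulmx0 mul0mx.
rewrite !rmorphD !rmorphM /= !horner_mx_X !horner_mx_C mulmxDr mulmxDl.
by rewrite -[_ * B]/(_ *m B) -[_ * A]/(_ *m A) mulmxA IHp -!mulmxA XA scalar_mxC.
Qed.

(** If no root of [char_poly A] were an eigenvalue of [B], then [char_poly A] at [B] would be a
    product of invertible factors [B - z]. Moving it across [X] turns it into its value at [A],
    which is 0, so [X] would vanish. *)
Lemma intertwining_common_eigenvalue (F : closedFieldType) (m n : nat)
    (A : 'M[F]_n.+1) (B : 'M[F]_m.+1) (X : 'M[F]_(m.+1, n.+1)) :
  X *m A = B *m X -> X != 0 -> exists2 z, eigenvalue A z & eigenvalue B z.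
Proof.
move=> XA Xn0; have [r charE] := closed_field_poly_normal (char_poly A).
rewrite (monicP (char_poly_monic A)) scale1r in charE.
have [/hasP[z zr Bz]|/hasPn noB] := boolP (has (eigenvalue B) r).
  by exists z; rewrite // eigenvalue_root_char charE root_prod_XsubC.
have unitB : horner_mx B (char_poly A) \is a GRing.unit.
  rewrite charE rmorph_prod big_seq; apply: rpred_prod => z /noB.
  rewrite rmorphB /= horner_mx_X horner_mx_C.
  by rewrite /eigenvalue negbK kermx_eq0 row_free_unit.
case/eqP: Xn0; rewrite -[X](mulKmx unitB X) -(intertwining_horner_mx _ XA).
by rewrite Cayley_Hamilton !mulmx0.
Qed.

(** * Skew-symmetric matrices in coordinates *)

Lemma mem_pair_list (n : nat) (z : 'I_n * 'I_n) :
  (z \in pair_list n) = (z.2 < z.1)%N.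
Proof.
case: z => p q; apply/allpairsPdep/idP => /= [[q' [p' [_]]]|qp].
  by rewrite mem_filter => /andP[qp _] [-> ->].
by exists q, p; rewrite [p \in _]mem_filter qp !mem_enum.
Qed.

Lemma uniq_pair_list (n : nat) : uniq (pair_list n).
Proof.
apply: allpairs_uniq_dep; first exact: enum_uniq.
  by move=> q _; rewrite filter_uniq ?enum_uniq.
by move=> [q p] [q' p'] _ _ /= [-> ->].
Qed.

Lemma pair_list_lt (n : nat) (x : 'I_('C(n, 2))) :
  ((tnth (pair_list n) x).2 < (tnth (pair_list n) x).1)%N.
Proof. by rewrite -mem_pair_list mem_tnth. Qed.

Lemma big_pair_list (V : nmodType) (n : nat) (F : 'I_n * 'I_n -> V) :
  \sum_x F (tnth (pair_list n) x) = \sum_(z : 'I_n * 'I_n | (z.2 < z.1)%N) F z.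
Proof.
rewrite -(big_tuple _ _ (pair_list n) xpredT F) big_uniq ?uniq_pair_list //=.
by apply: eq_bigl => z; rewrite mem_pair_list.
Qed.

(** The basis vector at the pair (p, q) stands for the exterior product of the basis vectors p and
    q. *)
Definition skew_mx (F : comNzRingType) (n : nat) (v : 'rV[F]_('C(n, 2))) : 'M[F]_n :=
  \sum_x v 0 x *: (delta_mx (tnth (pair_list n) x).1 (tnth (pair_list n) x).2
                   - delta_mx (tnth (pair_list n) x).2 (tnth (pair_list n) x).1).

Definition lower_coords (F : comNzRingType) (n : nat) (X : 'M[F]_n) : 'rV[F]_('C(n, 2)) :=
  \row_x X (tnth (pair_list n) x).1 (tnth (pair_list n) x).2.

(* [bialternate_sum] over an arbitrary ring, so that it can be taken over R[i]. *)
Definition bialternate (F : comNzRingType) (n : nat) (A : 'M[F]_n) :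
    'M[F]_('C(n, 2)) :=
  \matrix_(x, y)
    let: (p, q) := tnth (pair_list n) x in
    let: (r, s) := tnth (pair_list n) y in
    A p r * (q == s)%:R + A q s * (p == r)%:R
    - A p s * (q == r)%:R - A q r * (p == s)%:R.

Lemma lower_coordsB (F : comNzRingType) (n : nat) (X Y : 'M[F]_n) :
  lower_coords (X - Y) = lower_coords X - lower_coords Y.
Proof. by apply/rowP => x; rewrite !mxE. Qed.

Lemma skew_mxK (F : comNzRingType) (n : nat) :
  cancel (@skew_mx F n) (@lower_coords F n).
Proof.
move=> v; apply/rowP => x; rewrite mxE summxE (bigD1 x) //= !mxE !eqxx /=.
have ltx := pair_list_lt x.
have /negPf qNp : (tnth (pair_list n) x).2 != (tnth (pair_list n) x).1.
  by rewrite neq_ltn ltx.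
rewrite qNp andbF subr0 mulr1 big1 ?addr0 // => y yx; rewrite !mxE.
have lty := pair_list_lt y.
have /negPf : tnth (pair_list n) y != tnth (pair_list n) x.
  by apply: contra yx => /eqP/(tuple_uniqP _ (uniq_pair_list n))->.
move: ltx lty; case: (tnth _ x) (tnth _ y) => [p q] [r s] /= qp sr.
rewrite xpair_eqE eq_sym [s == q]eq_sym => ->.
(* Only the transposed pair could still contribute, but both pairs list their larger index first. *)
have [ps|] := eqVneq p s; have [qr|] := eqVneq q r; rewrite ?subr0 ?mulr0 //=.
by move: qp; rewrite ps qr ltnNge ltnW.
Qed.

(** The diagonal has its own hypothesis because skew-symmetry does not force it to vanish in
    characteristic 2. *)
Lemma lower_coordsK (F : comNzRingType) (n : nat) (X : 'M[F]_n) :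
  X^T = - X -> (forall i, X i i = 0) -> skew_mx (lower_coords X) = X.
Proof.
move=> /matrixP skX X0.
rewrite /skew_mx; under eq_bigr => x _ do rewrite mxE.
rewrite (big_pair_list (fun z : 'I_n * 'I_n =>
  X z.1 z.2 *: (delta_mx z.1 z.2 - delta_mx z.2 z.1))).
rewrite [RHS]matrix_sum_delta pair_bigA /=.
(* The entries split into lower triangle, diagonal and upper triangle; the last is carried onto the
   first by swapping indices. *)
rewrite [RHS](bigID (fun z : 'I_n * 'I_n => (z.2 < z.1)%N)) /=.
under eq_bigr => z _ do rewrite scalerBr.
rewrite big_split; congr (_ + _).
rewrite [RHS](bigID (fun z : 'I_n * 'I_n => z.1 == z.2)) /=.
rewrite [X in _ = X + _]big1 ?add0r; last first.
  by move=> [i j] /andP[_ /eqP/= <-]; rewrite X0 scale0r.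
rewrite (reindex_inj (h := fun z : 'I_n * 'I_n => (z.2, z.1))) /=; last first.
  by move=> [? ?] [? ?] [-> ->].
apply: eq_big => [[i j]|[i j] _] /=; first by rewrite -leqNgt ltn_neqAle andbC.
by have := skX i j; rewrite !mxE => ->; rewrite scaleNr opprK.
Qed.

(** * The action on skew-symmetric matrices *)

Lemma skew_mx_tr (F : comNzRingType) (n : nat) (v : 'rV[F]_('C(n, 2))) :
  (skew_mx v)^T = - skew_mx v.
Proof.
rewrite /skew_mx linear_sum -sumrN; apply: eq_bigr => x _.
by rewrite linearZ linearB /= !trmx_delta -scalerN opprB.
Qed.

(** By linearity it is enough to take [delta_mx p q - delta_mx q p] for the skew matrix: the four
    products with [A^T] and [A] then give the four terms of the bialternate sum. *)
Lemma mulmx_bialternate (F : comNzRingType) (n : nat) (A : 'M[F]_n) v :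
  v *m bialternate A = lower_coords (A^T *m skew_mx v + skew_mx v *m A).
Proof.
apply/rowP => y; rewrite [RHS]mxE /skew_mx mulmx_sumr mulmx_suml -big_split /= summxE.
rewrite mxE; apply: eq_bigr => x _; rewrite -scalemxAr -scalemxAl -scalerDr.
rewrite 2!mxE; congr (_ * _).
have delta_r i j k l : (A^T *m delta_mx i j) k l = A i k * (j == l)%:R.
  rewrite mxE (bigD1 i) //= big1 ?addr0 => [|h hi]; first by rewrite !mxE eqxx eq_sym.
  by rewrite !mxE (negPf hi) mulr0.
have delta_l i j k l : (delta_mx i j *m A) k l = (i == k)%:R * A j l.
  rewrite mxE (bigD1 j) //= big1 ?addr0 => [|h hi]; first by rewrite !mxE eqxx andbT eq_sym.
  by rewrite !mxE (negPf hi) andbF mul0r.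
(* Unlike [mxE], these rules leave matrix products folded for [delta_r] and [delta_l]. *)
have addE (X Y : 'M[F]_n) i j : (X + Y) i j = X i j + Y i j by rewrite mxE.
have oppE (X : 'M[F]_n) i j : (- X) i j = - X i j by rewrite mxE.
rewrite mulmxBr mulmxBl !(addE, oppE, delta_r, delta_l).
case: (tnth _ x) (tnth _ y) => [p q] [r s] /=; ring.
Qed.

Lemma skew_lyapunov (F : comNzRingType) (n : nat) (A X : 'M[F]_n) :
  X^T = - X -> (A^T *m X + X *m A)^T = - (A^T *m X + X *m A).
Proof. by move=> sX; rewrite linearD /= !trmx_mul trmxK sX mulNmx mulmxN addrC opprD. Qed.

Lemma skew_diag0 (F : idomainType) (n : nat) (X : 'M[F]_n) :
  2%:R != 0 :> F -> X^T = - X -> forall i, X i i = 0.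
Proof.
move=> F2 /matrixP sX i; have /eqP := sX i i.
by rewrite !mxE -addr_eq0 -mulr2n -mulr_natl mulf_eq0 (negPf F2) => /eqP.
Qed.

(** A product of two bialternate sums acts by composing the two actions, the left factor first. In
    the commutator the mixed terms, such as [A^T *m X *m B], cancel. *)
Lemma bialternate_lie (F : idomainType) (n : nat) (A B : 'M[F]_n) :
  2%:R != 0 :> F ->
  bialternate (A *m B - B *m A)
  = bialternate A *m bialternate B - bialternate B *m bialternate A.
Proof.
move=> F2; apply/row_matrixP => i; rewrite !rowE.
set v := delta_mx _ _; move: v => v.
have prod C D : v *m (bialternate C *m bialternate D) = lower_coords
    (D^T *m (C^T *m skew_mx v + skew_mx v *m C)
     + (C^T *m skew_mx v + skew_mx v *m C) *m D).
  have sk := skew_lyapunov C (skew_mx_tr v).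
  rewrite mulmxA !mulmx_bialternate lower_coordsK //; exact: skew_diag0.
rewrite mulmxBr !prod mulmx_bialternate -lower_coordsB; congr lower_coords.
rewrite linearB /= !trmx_mul !mulmxDr !mulmxDl !mulNmx !mulmxN !mulmxA.
(* Each product entry is a sum, generalized to an atom for [ring]. *)
by apply/matrixP => j k; do ![rewrite !mxE; set u := \sum_(_ < _) _; move: u => ?]; ring.
Qed.

Lemma bialternate_det0P (F : idomainType) (n : nat) (A : 'M[F]_n) :
  2%:R != 0 :> F ->
  reflect (exists X : 'M[F]_n, [/\ X != 0, X^T = - X & A^T *m X + X *m A = 0])
          (\det (bialternate A) == 0).
Proof.
move=> F2; apply: (iffP det0P) => [[v vn0 vA]|[X [Xn0 sX AX]]].
  have sv := skew_mx_tr v; exists (skew_mx v); split=> //.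
    apply: contra vn0 => /eqP v0; rewrite -[v]skew_mxK v0.
    by apply/eqP/rowP => x; rewrite !mxE.
  move: vA; rewrite mulmx_bialternate => /(congr1 (@skew_mx F n)).
  rewrite lower_coordsK; [|exact: skew_lyapunov|exact/skew_diag0/skew_lyapunov].
  by move=> ->; rewrite /skew_mx big1 // => x _; rewrite mxE scale0r.
have XE : skew_mx (lower_coords X) = X by rewrite lower_coordsK //; exact: skew_diag0.
exists (lower_coords X).
  apply: contra Xn0 => /eqP X0; rewrite -XE X0.
  by rewrite /skew_mx big1 // => x _; rewrite mxE scale0r.
by rewrite mulmx_bialternate XE AX; apply/rowP => x; rewrite !mxE.
Qed.

Lemma map_bialternate (F K : comNzRingType) (f : {rmorphism F -> K}) (n : nat)
    (A : 'M[F]_n) :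
  map_mx f (bialternate A) = bialternate (map_mx f A).
Proof.
apply/matrixP => x y; rewrite !mxE.
case: (tnth _ x) (tnth _ y) => [p q] [r s].
by rewrite !mxE !rmorphB rmorphD !rmorphM /= !rmorph_nat.
Qed.

(** * Opposite eigenvalues and the vanishing of the determinant *)

Lemma eigenvalue_trmx (F : fieldType) (n : nat) (A : 'M[F]_n) :
  eigenvalue A^T =1 eigenvalue A.
Proof.
move=> z; rewrite /eigenvalue !kermx_eq0 !row_free_unit -unitmx_tr.
by rewrite linearB /= trmxK tr_scalar_mx.
Qed.

Lemma eigenvalueN (F : fieldType) (n : nat) (A : 'M[F]_n) (z : F) :
  eigenvalue (- A) z = eigenvalue A (- z).
Proof.
by apply/eigenvalueP/eigenvalueP => -[v vA vn0]; exists v => //;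
  [rewrite scaleNr -vA mulmxN opprK | rewrite mulmxN vA scaleNr opprK].
Qed.

Lemma bialternate_det0_eigenvalue_opp (F : closedFieldType) (n : nat) (A : 'M[F]_n) :
  2%:R != 0 :> F -> \det (bialternate A) = 0 ->
  exists2 z, eigenvalue A z & eigenvalue A (- z).
Proof.
move=> F2 /eqP/(bialternate_det0P _ F2)[X [Xn0 _ AX]].
(* Evaluating polynomials at a matrix needs positive size; in size 0 every [X] is 0. *)
case: n A X Xn0 AX => [|n] A X Xn0 AX; first by rewrite flatmx0 eqxx in Xn0.
have XA : X *m A = (- A^T) *m X by apply/eqP; rewrite mulNmx -addr_eq0 addrC AX.
have [z Az] := intertwining_common_eigenvalue XA Xn0.
by rewrite eigenvalueN eigenvalue_trmx; exists z.
Qed.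

Lemma eigenvalue_opp_bialternate_det0 (F : fieldType) (n : nat) (A : 'M[F]_n) (z : F) :
  2%:R != 0 :> F -> z != 0 -> eigenvalue A z -> eigenvalue A (- z) ->
  \det (bialternate A) = 0.
Proof.
move=> F2 z0 /eigenvalueP[v vA vn0] /eigenvalueP[w wA wn0].
apply/eqP/bialternate_det0P => //; exists (v^T *m w - w^T *m v); split.
(* If [v^T *m w] equalled [w^T *m v], multiplying by [A] on the right would scale it by both [- z]
   and [z]. It would then be 0, although an outer product of nonzero vectors has a nonzero entry. *)
- apply/eqP => /eqP; rewrite subr_eq0 => /eqP vw.
  have /eqP : z *: (v^T *m w) = - z *: (v^T *m w).
    by rewrite {1}vw scalemxAr -vA mulmxA -vw -mulmxA wA -scalemxAr.
  rewrite -subr_eq0 -scalerBl opprK -mulr2n -mulr_natl scaler_eq0 mulf_eq0.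
  rewrite (negPf F2) (negPf z0) /= => /eqP vw0.
  have [i vi] : exists i, v 0 i != 0 by apply/rV0Pn.
  have [j wj] : exists j, w 0 j != 0 by apply/rV0Pn.
  move/matrixP/(_ i j): vw0; rewrite !mxE big_ord1 !mxE => /eqP.
  by rewrite mulf_eq0 (negPf vi) (negPf wj).
- by rewrite linearB /= !trmx_mul !trmxK opprB.
rewrite mulmxBr mulmxBl !mulmxA -!trmx_mul vA wA -!mulmxA vA wA.
rewrite !linearZ /= -!scalemxAl.
by rewrite !scaleNr opprK scalerN -opprD subrr.
Qed.

Lemma eigenvalue_conjc (R : rcfType) (n : nat) (A : 'M[R]_n) (z : R[i]) :
  eigenvalue (map_mx (real_complex R) A) z ->
  eigenvalue (map_mx (real_complex R) A) (conjc z).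
Proof.
move=> /eigenvalueP[v vA vn0]; apply/eigenvalueP; exists (map_mx (@conjc R) v).
  rewrite -map_mxZ -vA map_mxM; congr (_ *m _); apply/matrixP => i j.
  by rewrite !mxE; apply/esym/conjc_real.
by rewrite map_mx_eq0.
Qed.

Theorem corollary1 (R : realType) (n : nat) (hn : (2 <= n)%N) :
  guardian_representation (fun A : 'M[R]_n => bialternate_sum A).
Proof.
(* Eigenvalues live in [R[i]], so the determinant is moved there. *)
have detC (A : 'M[R]_n) : (\det (bialternate_sum A) == 0)
    = (\det (bialternate (map_mx (real_complex R) A)) == 0).
  by rewrite -map_bialternate det_map_mx fmorph_eq0.
have C2 : 2%:R != 0 :> R[i] by rewrite pnatr_eq0.
split; first split.
- move=> a A B; apply/matrixP => x y; rewrite !mxE.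
  by case: (tnth _ x) (tnth _ y) => [p q] [r s]; rewrite !mxE; ring.
- by move=> A B; apply: bialternate_lie; rewrite pnatr_eq0.
(* (G1) fails: diag(0, -1, ..., -1) has eigenvalue 0, but its bialternate sum is diagonal with the
   nonzero entries -1 and -2 only. *)
right; split=> [A stA /eqP|A [b [b0 Ab]]].
  rewrite detC => /eqP/(bialternate_det0_eigenvalue_opp C2)[z /stA z0 /stA].
  by case: z z0 => x y /=; rewrite oppr_lt0 => /lt_trans/[apply]; rewrite ltxx.
have z0 : Complex 0 b != 0 by rewrite eq_complex /= eqxx (introN eqP b0).
(* For a purely imaginary number the opposite is the conjugate, which is again an eigenvalue because
   [A] is real. *)
have zN : - Complex 0 b = conjc (Complex 0 b).
  by apply/eqP; rewrite eq_complex /= oppr0 !eqxx.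
have Azc := eigenvalue_conjc Ab; rewrite -zN in Azc.
by apply/eqP; rewrite detC (eigenvalue_opp_bialternate_det0 C2 z0 Ab Azc).
Qed.
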